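(* The $(\min,-)$ convolution of two vectors of length $n$ can be computed in $O(n\sqrt n)$ time in the nonuniform linear decision tree model.
   Context: For vectors $\vec x=\langle x_0,\dots,x_{n-1}\rangle$, $\vec y=\langle y_0,\dots,y_{n-1}\rangle$ of reals, the $(\min,-)$ convolution is the vector whose $k$th entry is $\min_{i=0}^{k}(x_i-y_{k-i})$, $k=0,\dots,n-1$. In the nonuniform linear decision tree model, for each input size there is a separate decision tree whose internal nodes test the sign of a linear function of the input values; the cost is the depth of the tree. *)

(* Defs.v *)
From HB Require Import structures.
From mathcomp Require Import all_boot all_order all_algebra.
Set Implicit Arguments. Unset Strict Implicit. Unset Printing Implicit Defensive.
Import Order.TTheory GRing.Theory Num.Theory.
Local Open Scope ring_scope.

(* (min,-) convolution: entry k is min_{i=0..k} (x_i - y_{k-i}).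
   Vectors are given as functions nat -> R; only indices < n are used. *)
Definition minconv (R : realFieldType) (x y : nat -> R) (k : nat) : R :=
  \big[Num.min/(x 0%N - y k)]_(0 <= i < k.+1) (x i - y (k - i)%N).

(* Linear decision tree on m real inputs with leaves labelled in O.
   An internal node carries the coefficients c of the linear form
   sum_j c_j v_j and three children, for sign <0, =0, >0. *)
Inductive ldt (R : Type) (m : nat) (O : Type) : Type :=
| Leaf : O -> ldt R m O
| Node : ('I_m -> R) -> ldt R m O -> ldt R m O -> ldt R m O -> ldt R m O.

Fixpoint ldt_eval (R : realFieldType) (m : nat) (O : Type)
    (t : ldt R m O) (v : 'I_m -> R) : O :=
  match t with
  | Leaf o => o
  | Node c tl te tg =>
      let s := \sum_(j < m) c j * v j in
      if s < 0 then ldt_eval tl v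
      else if s == 0 then ldt_eval te v
      else ldt_eval tg v
  end.

Fixpoint ldt_depth (R : Type) (m : nat) (O : Type) (t : ldt R m O) : nat :=
  match t with
  | Leaf _ => 0%N
  | Node _ tl te tg => (maxn (ldt_depth tl) (maxn (ldt_depth te) (ldt_depth tg))).+1
  end.

Definition conv_input (R : Type) (n : nat) (x y : nat -> R) : 'I_(n + n) -> R :=
  fun j => if (j < n)%N then x j else y (j - n)%N.

Definition computes_minconv (R : realFieldType) (n : nat)
    (t : ldt R (n + n) ('I_n -> nat)) : Prop :=
  forall x y : nat -> R, forall k : 'I_n,
    let i := ldt_eval t (@conv_input R n x y) k in
    (i <= k)%N /\ x i - y (k - i)%N = minconv x y k.

(* Main.v *)
(* Cut the index range into blocks of length d = sqrt n.  Since
   x_i - y_(k-i) <= x_j - y_(k-j) iff x_i - x_j <= y_(k-i) - y_(k-j), sorting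
   the 2 n d values x_i - x_(i+e), y_(l+e) - y_l with e < d reveals the
   minimiser of every block for every k; each of the n entries is then a minimum
   of at most n/d + 1 known candidates.  The sort costs O(nd) and not
   O(nd log n): the differences are linear forms in 2n variables, so the
   comparisons among them have only (nd)^O(n) joint outcomes, and insertion sort
   with a search balanced by the number of remaining outcomes (Fredman) makes
   O(nd + n log (nd)) comparisons. *)
Require Import Defs.
From HB Require Import structures.
From mathcomp Require Import all_boot all_order all_algebra.
From mathcomp Require Import boolp zify lra.
Set Implicit Arguments. Unset Strict Implicit. Unset Printing Implicit Defensive.
Import Order.TTheory GRing.Theory Num.Theory.
Local Open Scope ring_scope.

(** * Counting sign patterns of linear forms *)

Lemma leq_expl (a b e : nat) : (a <= b -> a ^ e <= b ^ e)%N.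
Proof. by case: e => // e ab; rewrite leq_exp2r. Qed.

(** Makes sign cells convex cones: a segment joining two points of a cell on opposite sides of a
    hyperplane crosses it inside the cell. *)
Lemma sgr_conic (R : realFieldType) (a b x y : R) :
  0 < a -> 0 < b -> Num.sg x = Num.sg y -> Num.sg (a * x + b * y) = Num.sg x.
Proof.
move=> a0 b0 h; have [x0|x0|x0] := ltrgt0P x.
- have y0 : 0 < y by rewrite -sgr_gt0 -h sgr_gt0.
  by rewrite (gtr0_sg x0) gtr0_sg // addr_gt0 // mulr_gt0.
- have y0 : y < 0 by rewrite -sgr_lt0 -h sgr_lt0.
  by rewrite (ltr0_sg x0) ltr0_sg // -oppr_gt0 opprD -!mulrN addr_gt0 // mulr_gt0 // oppr_gt0.
- have /eqP-> : y == 0 by rewrite -sgr_eq0 -h sgr_eq0 x0.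
  by rewrite x0 !mulr0 addr0.
Qed.

(* Adding a form f splits a cell into several only if the cell meets ker f, and
   those cells are counted in dimension n - 1: with c m n cells for m forms,
   c (m + 1) n <= c m n + 2 c m (n - 1). *)
Lemma sign_cells (R : realFieldType) (m n : nat) (fs : seq 'cV[R]_n) :
  size fs = m ->
  exists L : seq 'rV[R]_n, (size L <= (2 * m + 1) ^ n)%N /\
    forall v : 'rV_n, exists2 u, u \in L & forall f, f \in fs ->
      Num.sg ((v *m f) 0 0) = Num.sg ((u *m f) 0 0).
Proof.
elim: m n fs => [|m IH] n [|f fs] //=.
  move=> _; exists [:: 0]; split; first by rewrite exp1n.
  by move=> v; exists 0; rewrite ?mem_head.
case=> hm; have [L [sL hL]] := IH n fs hm.
have [f0|f0] := eqVneq f 0.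
  exists L; split; first by apply: leq_trans sL _; apply: leq_expl; lia.
  move=> v; have [u uL hu] := hL v; exists u => // g; rewrite inE => /orP[/eqP->|/hu//].
  by rewrite f0 !mulmx0.
(* The rows of [K] are a basis of ker f, so a form g restricts there to [K *m g] in n - 1
   variables. *)
set K := row_base (kermx f).
have n0 : (0 < n)%N.
  by case: n f f0 {fs hm L sL hL K} => // f; rewrite [f]flatmx0 eqxx.
have rK : \rank (kermx f) = n.-1.
  rewrite mxrank_ker; have f1 : (\rank f <= 1)%N by apply: rank_leq_col.
  by move: f0; rewrite -mxrank_eq0; lia.
have [M [sM hM]] := IH _ [seq K *m g | g <- fs] (etrans (size_map _ _) hm).
pose cell (u v : 'rV_n) := forall g, g \in fs -> Num.sg ((v *m g) 0 0) = Num.sg ((u *m g) 0 0).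
have ker_cell v : (v *m f) 0 0 = 0 -> exists2 w, w \in M & cell (w *m K) v.
  move=> vf; have /submxP[w ->] : (v <= K)%MS.
    rewrite eq_row_base; apply/sub_kermxP.
    by rewrite [LHS]mx11_scalar vf raddf0.
  have [u uM hu] := hM w; exists u => // g gfs.
  by rewrite -(mulmxA w K g) -(mulmxA u K g); apply: hu; apply: map_f.
have pick_cell (P : pred 'rV[R]_n) u : exists u', forall v, cell u v -> P v -> cell u u' /\ P u'.
  case: (EM (exists v, cell u v /\ P v)) => [[v hv]|h]; first by exists v.
  by exists u => v h1 h2; case: h; exists v.
have [neg hneg] := choice (pick_cell (fun v => (v *m f) 0 0 < 0)).
have [pos hpos] := choice (pick_cell (fun v => 0 < (v *m f) 0 0)).
(* [side u] represents the positive part of an old cell if there is one, otherwise the negative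
   part. A cell with both parts meets ker f, so a kernel point [w *m K] represents its zero part and
   [neg (w *m K)] its negative part. *)
pose side u := if `[< cell u (pos u) /\ 0 < (pos u *m f) 0 0 >] then pos u else neg u.
exists ([seq side u | u <- L] ++ ([seq neg (w *m K) | w <- M] ++ [seq w *m K | w <- M])).
split.
  have {}sM : (size M <= (2 * m + 1) ^ n.-1)%N by rewrite -rK.
  rewrite !size_cat !size_map; move: sM sL.
  have expE b : (b ^ n = b * b ^ n.-1)%N by rewrite -expnS prednK.
  rewrite !expE.
  have AB : ((2 * m + 1) ^ n.-1 <= (2 * m.+1 + 1) ^ n.-1)%N by apply: leq_expl; lia.
  have := leq_mul (leqnn (2 * m + 1)) AB; move: AB.
  move: ((2 * m + 1) ^ n.-1)%N ((2 * m.+1 + 1) ^ n.-1)%N => A B.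
  by move: (size M) (size L) => a b; lia.
have cellE u v : cell u v -> Num.sg ((v *m f) 0 0) = Num.sg ((u *m f) 0 0) ->
    forall g, g \in f :: fs -> Num.sg ((v *m g) 0 0) = Num.sg ((u *m g) 0 0).
  by move=> h h0 g; rewrite inE => /orP[/eqP->|/h].
move=> v; have [u uL uv] := hL v; have {}uv : cell u v by [].
have [vf|vf|vf] := ltrgt0P ((v *m f) 0 0).
- have [cu pu] := hpos _ _ uv vf.
  exists (side u); first by rewrite mem_cat map_f.
  rewrite /side asboolT //; apply: cellE; last by rewrite !gtr0_sg.
  by move=> g gfs; rewrite (uv g gfs) (cu g gfs).
- have [[cu pu]|h] := EM (cell u (pos u) /\ 0 < (pos u *m f) 0 0).
    (* Both weights are positive and chosen to make f vanish at [w]. *)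
    pose w := (pos u *m f) 0 0 *: v + (- (v *m f) 0 0) *: pos u.
    have wE g : (w *m g) 0 0 =
        (pos u *m f) 0 0 * (v *m g) 0 0 + (- (v *m f) 0 0) * (pos u *m g) 0 0.
      by rewrite mulmxDl -!scalemxAl !mxE.
    have [|x xM xw] := ker_cell w; first by rewrite wE mulNr mulrC subrr.
    have xv : cell (x *m K) v.
      move=> g gfs; rewrite -(xw g gfs) wE sgr_conic // ?oppr_gt0 //.
      by rewrite (uv g gfs) (cu g gfs).
    have [cn pn] := hneg _ _ xv vf.
    exists (neg (x *m K)); first by rewrite !mem_cat (map_f (fun w => neg (w *m K))) // orbT.
    apply: cellE; last by rewrite !ltr0_sg.
    by move=> g gfs; rewrite (xv g gfs) (cn g gfs).
  have [cn pn] := hneg _ _ uv vf.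
  exists (side u); first by rewrite mem_cat map_f.
  rewrite /side asboolF //; apply: cellE; last by rewrite !ltr0_sg.
  by move=> g gfs; rewrite (uv g gfs) (cn g gfs).
- have [x xM xv] := ker_cell v vf.
  exists (x *m K); first by rewrite !mem_cat (map_f (fun w => w *m K)) // !orbT.
  apply: cellE => //; rewrite vf -mulmxA.
  have /sub_kermxP -> : (K <= kermx f)%MS by rewrite eq_row_base.
  by rewrite mulmx0 mxE.
Qed.

(** * Insertion ranks of strict total orders *)

Section InsertionRank.
Implicit Types (lt : rel nat) (j a b p : nat).

Definition strict_total lt :=
  [/\ irreflexive lt, transitive lt & forall a b, a != b -> lt a b || lt b a].

(** For [a = j] this is the position at which insertion sort places j among its predecessors. *)
Definition below lt j a : nat := #|[set i : 'I_j | lt i a]|.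

(** When [lt a b], the element [a] itself witnesses strict inclusion of the two counted sets. Since
    [b] is arbitrary, [b = j] is allowed, which locates a new element among the old ones. *)
Lemma below_lt lt j a b : strict_total lt -> (a < j)%N ->
  lt a b = (below lt j a < below lt j b)%N.
Proof.
move=> [irr tr tot] aj; have [lab|nlab] := boolP (lt a b); apply/esym.
  apply: proper_card; apply/properP; split.
    by apply/subsetP => i; rewrite !inE => ia; apply: tr lab.
  by exists (Ordinal aj); rewrite !inE ?irr.
have [->|ab] := eqVneq a b; first by rewrite ltnn.
have lba : lt b a by have := tot _ _ ab; rewrite (negPf nlab).
apply/negbTE; rewrite -leqNgt; apply: subset_leq_card.
by apply/subsetP => i; rewrite !inE => ib; apply: tr lba.
Qed.

Lemma below_le lt j a : (below lt j a <= j)%N.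
Proof. by rewrite -[leqRHS]card_ord max_card. Qed.

(** Distinct elements have distinct ranks, and an injection of a finite set into itself is onto. The
    element found serves as the pivot of a rank test. *)
Lemma below_onto lt j p : strict_total lt -> (p < j)%N ->
  exists2 a, (a < j)%N & below lt j a = p.
Proof.
move=> st pj; have [irr _ tot] := st.
have bj (a : 'I_j) : (below lt j a < j)%N.
  rewrite -[ltnRHS]card_ord; apply: proper_card; apply/properP; split.
    exact: subset_predT.
  by exists a; rewrite ?inE ?irr.
pose f (a : 'I_j) := Ordinal (bj a).
have f_inj : injective f.
  move=> a b [] eab; apply/eqP/negP => /negP nab.
  by have := tot _ _ nab; rewrite !(below_lt _ st (ltn_ord _)) eab ltnn.
have [g _ gK] := injF_bij f_inj.
by exists (g (Ordinal pj)) => //; have /(congr1 val) := gK (Ordinal pj).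
Qed.

Lemma eq_below lt1 lt2 j a : (forall i, (i < j)%N -> lt1 i a = lt2 i a) ->
  below lt1 j a = below lt2 j a.
Proof. by move=> h; apply: eq_card => i; rewrite !inE h. Qed.

(** By induction the orders agree on the old elements; by [below_lt], the rank of the new element
    then fixes its comparison with each of them. *)
Lemma insertion_ranks_inj lt1 lt2 m : strict_total lt1 -> strict_total lt2 ->
  (forall j, (j < m)%N -> below lt1 j j = below lt2 j j) ->
  forall a b, (a < m)%N -> (b < m)%N -> lt1 a b = lt2 a b.
Proof.
move=> st1 st2; elim: m => // m IH h.
have {}IH a b : (a < m)%N -> (b < m)%N -> lt1 a b = lt2 a b.
  by apply: IH => j jm; apply: h; apply: ltnW.
have new a : (a < m)%N -> lt1 a m = lt2 a m.
  move=> am; rewrite (below_lt _ st1 am) (below_lt _ st2 am).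
  by rewrite h // (@eq_below lt1 lt2 m a) // => i im; apply: IH.
have flip lt a : strict_total lt -> (a < m)%N -> lt m a = ~~ lt a m.
  case=> irr tr tot am; have := tot a m; rewrite (ltn_eqF am) => /(_ isT).
  by case: (boolP (lt a m)) => //= lam _; apply/negP => /(tr _ _ _ lam); rewrite irr.
move=> a b; rewrite !ltnS [(a <= m)%N]leq_eqVlt [(b <= m)%N]leq_eqVlt.
case/orP=> [/eqP->|am]; case/orP=> [/eqP->|bm].
- by case: st1 => -> _ _; case: st2 => -> _ _.
- by rewrite !flip // new.
- exact: new.
- exact: IH.
Qed.

End InsertionRank.

(** * Decision trees for searching, sorting and minima *)

Section Trees.
Variables (R : realFieldType) (m : nat) (O : Type).
Implicit Types (A : ('I_m -> R) -> Prop) (Q : ('I_m -> R) -> O -> Prop) (D : nat).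

Definition lin (c v : 'I_m -> R) : R := \sum_(j < m) c j * v j.

Lemma lin_sub (c d : 'I_m -> R) v : lin (fun j => c j - d j) v = lin c v - lin d v.
Proof. by rewrite -sumrB; apply: eq_bigr => j _; rewrite mulrBl. Qed.

(** [A] is the knowledge gained on the path so far; only inputs satisfying it must be answered
    correctly. *)
Definition solves D A Q := exists t : ldt R m O,
  (ldt_depth t <= D)%N /\ forall v, A v -> Q v (ldt_eval t v).

Lemma solvesW D D' A A' Q :
  solves D A Q -> (D <= D')%N -> (forall v, A' v -> A v) -> solves D' A' Q.
Proof.
move=> [t [dt ht]] DD' AA'; exists t; split; first exact: leq_trans DD'.
by move=> v /AA'; apply: ht.
Qed.

Lemma solves_test c D A Q :
  solves D (fun v => A v /\ lin c v <= 0) Q ->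
  solves D (fun v => A v /\ 0 < lin c v) Q -> solves D.+1 A Q.
Proof.
move=> [t1 [d1 h1]] [t2 [d2 h2]]; exists (Node c t1 t1 t2); split.
  by rewrite /= ltnS !geq_max d1 d2.
move=> v Av; rewrite /= -/(lin c v); have [lt0|gt0|eq0] := ltrgt0P (lin c v).
- by apply: h2.
- by apply: h1; split=> //; apply: ltW.
- by apply: h1; rewrite eq0.
Qed.

(* Splitting at the median code value by the two tests c < p and c <= p either
   halves the candidate list L or determines the code value at j, which is the
   reason for the potential 2 (N - j) + 2 log #L. *)
Lemma search_code N (code : ('I_m -> R) -> nat -> nat) (D0 : nat) Q :
  (forall j p s A D, (j < N)%N ->
     (forall v, A v -> forall i, (i < j)%N -> code v i = s i) ->
     solves D (fun v => A v /\ (code v j < p)%N) Q ->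
     solves D (fun v => A v /\ (p <= code v j)%N) Q -> solves D.+1 A Q) ->
  (forall s, solves D0 (fun v => forall i, (i < N)%N -> code v i = s i) Q) ->
  forall l j s A (L : seq ('I_m -> R)), (j <= N)%N -> (size L <= 2 ^ l)%N ->
    (forall v, A v -> forall i, (i < j)%N -> code v i = s i) ->
    (forall v, A v -> has (fun u => [forall i : 'I_N, code u i == code v i]) L) ->
    solves (2 * (N - j) + 2 * l + D0) A Q.
Proof.
move=> split_code final l j s A L.
have [h] := ubnP (N - j + l); elim: h => // h IH in l j s A L * => hlt jN sL As cov.
have [eqN|jN'] := eqVneq j N.
  by apply: solvesW (final s) _ _; [rewrite leq_addl | rewrite -eqN].
have {jN'}jN : (j < N)%N by rewrite ltn_neqAle jN' jN.
have [L0|L0] := posnP (size L).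
  apply: solvesW (final s) _ _; first by rewrite leq_addl.
  by move=> v /cov; rewrite (size0nil L0).
have ex_med : exists p, (size L <= 2 * count (fun u => code u j <= p) L)%N.
  exists (\max_(u <- L) code u j)%N; rewrite (_ : count _ _ = size L); first lia.
  by apply/eqP; rewrite -all_count; apply/allP => u uL; apply: leq_bigmax_seq.
(* [p] is a median: its minimality bounds the candidates with code below [p], its defining property
   those above. *)
have [p p_ge p_min] := ex_minnP ex_med.
have lo : (2 * count (fun u => code u j < p) L <= size L)%N.
  case: p p_min {p_ge} => [|p] p_min; first by rewrite (eq_count (a2 := pred0)) ?count_pred0.
  by rewrite leqNgt; apply/negP => /ltnW/p_min; rewrite ltnn.
have hi : (2 * count (fun u => p < code u j) L <= size L)%N.
  have := count_predC (fun u => code u j <= p)%N L.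
  rewrite (eq_count (a1 := predC _) (a2 := fun u => p < code u j)%N); first lia.
  by move=> u; rewrite /= ltnNge.
have half (B : pred nat) : (2 * count (fun u => B (code u j)) L <= size L)%N ->
    solves (2 * (N - j) + 2 * l + D0 - 2) (fun v => A v /\ B (code v j)) Q.
  move=> hB; have cov' v : A v /\ B (code v j) ->
      has (fun u => [forall i : 'I_N, code u i == code v i]) [seq u <- L | B (code u j)].
    move=> [Av Bv]; have /hasP[u uL /forallP hu] := cov v Av; apply/hasP.
    exists u; last exact/forallP.
    by rewrite mem_filter uL andbT (eqP (hu (Ordinal jN))).
  (* At [l = 0] there is at most one candidate, so half of the list is empty and no input reaches
     this branch. *)
  case: l hlt sL => [|l] hlt sL.
    have /size0nil F0 : size [seq u <- L | B (code u j)] = 0%N.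
      by rewrite size_filter; move: sL hB; rewrite expn0; lia.
    apply: solvesW (final s) _ _; first by lia.
    by move=> v /cov'; rewrite F0.
  apply: solvesW (IH l j s _ [seq u <- L | B (code u j)] _ _ _ _ cov') _ _ => //; try lia.
  - by rewrite size_filter; move: sL hB; rewrite expnS; lia.
  - by move=> v [/As].
(* At most two tests are made, paid for by lowering [l] in the outer branches and raising [j] in the
   middle one. *)
have -> : (2 * (N - j) + 2 * l + D0 = (2 * (N - j) + 2 * l + D0 - 2).+2)%N by lia.
apply: (split_code j p s) => //.
  by apply: solvesW (half (fun c => c < p)%N lo) _ _.
apply: (split_code j p.+1 s) => //; first by move=> v [/As].
  apply: solvesW (IH l j.+1 (fun i => if i == j then p else s i)
    (fun v => A v /\ code v j = p) L _ _ _ _ _) _ _ => //; try lia.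
  - move=> v [Av <-] i; rewrite ltnS leq_eqVlt; case: eqP => [->//|_] /= ij.
    exact: As.
  - by move=> v [/cov].
  - by move=> v [[Av h1] h2]; split=> //; lia.
by apply: solvesW (half (fun c => p < c)%N hi) _ _ => // v [[]].
Qed.

(** Breaking ties by index gives a strict total order in which each comparison is still a single
    linear test. *)
Definition form_lt (z : nat -> 'I_m -> R) v : rel nat := fun a b =>
  (lin (z a) v < lin (z b) v) || (lin (z a) v == lin (z b) v) && (a < b)%N.

Lemma form_lt_strict_total z v : strict_total (form_lt z v).
Proof.
rewrite /form_lt; split=> [a|b a c|a b ab]; first by rewrite ltxx eqxx ltnn.
- case/orP=> [ab|/andP[/eqP-> ab]]; case/orP=> [bc|/andP[/eqP<- bc]].
  + by rewrite (lt_trans ab).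
  + by rewrite ab.
  + by rewrite bc.
  + by rewrite eqxx (ltn_trans ab) ?orbT.
- by case: ltrgtP => //= _; rewrite -neq_ltn.
Qed.

Lemma form_lt_le z v a b : (a < b)%N -> form_lt z v a b = (lin (z a) v <= lin (z b) v).
Proof. by rewrite /form_lt => ->; rewrite andbT orbC -le_eqVlt. Qed.

(** The signs of the N ^ 2 differences of forms determine the order, ties included, so [sign_cells]
    applies to them. *)
Lemma form_lt_cells (z : nat -> 'I_m -> R) N :
  exists L : seq ('I_m -> R), (size L <= (2 * N ^ 2 + 1) ^ m)%N /\
    forall v, has (fun u => [forall a : 'I_N, forall b : 'I_N,
      form_lt z u a b == form_lt z v a b]) L.
Proof.
pose diff a b : 'cV[R]_m := \col_k (z a k - z b k).
pose fs := [seq diff a b | a <- iota 0 N, b <- iota 0 N].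
have sfs : size fs = (N ^ 2)%N by rewrite size_allpairs !size_iota mulnn.
have [L [sL hL]] := sign_cells sfs.
exists [seq (fun k => u 0 k) | u : 'rV[R]_m <- L]; split; first by rewrite size_map.
move=> v; have [u uL hu] := hL (\row_k v k).
rewrite has_map; apply/hasP; exists u => //=.
apply/forallP => a; apply/forallP => b.
have linE (w : 'rV[R]_m) : lin (z a) (fun k => w 0 k) - lin (z b) (fun k => w 0 k) =
    (w *m diff a b) 0 0.
  by rewrite -lin_sub mxE; apply: eq_bigr => k _; rewrite mxE mulrC.
have linv c : lin c v = lin c (fun k => (\row_k v k) 0 k).
  by apply: eq_bigr => k _; rewrite mxE.
have /hu ab_sg : diff a b \in fs by apply: allpairs_f; rewrite mem_iota ltn_ord.
have ltE x : form_lt z x a b = (lin (z a) x - lin (z b) x < 0) ||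
    (lin (z a) x - lin (z b) x == 0) && (a < b)%N by rewrite subr_lt0 subr_eq0.
by rewrite !ltE !linv !linE -sgr_lt0 -sgr_eq0 -ab_sg sgr_lt0 sgr_eq0.
Qed.

Lemma solves_sort (z : nat -> 'I_m -> R) N l D0 Q :
  ((2 * N ^ 2 + 1) ^ m <= 2 ^ l)%N ->
  (forall u, solves D0 (fun v => forall a b, (a < N)%N -> (b < N)%N ->
     form_lt z v a b = form_lt z u a b) Q) ->
  solves (2 * N + 2 * l + D0) (fun=> True) Q.
Proof.
move=> hl final; have st v := form_lt_strict_total z v.
pose code v j := below (form_lt z v) j j.
have final_u D (u : 'I_m -> R) A : (D0 <= D)%N ->
    (forall v, A v -> forall a b, (a < N)%N -> (b < N)%N ->
      form_lt z v a b = form_lt z u a b) -> solves D A Q.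
  by move=> D0D h; apply: solvesW (final u) _ _.
have [L [sL cov]] := form_lt_cells z N.
rewrite -[(2 * N)%N](congr1 (muln 2) (subn0 N)).
apply: (@search_code N code D0 Q _ _ l 0%N (fun=> 0%N) _ L (leq0n N)
  (leq_trans sL hl)) => //; last first.
- move=> v _; apply: sub_has (cov v) => u /forallP huv; apply/forallP => i.
  apply/eqP/eq_below => a ai; apply/eqP.
  by have /forallP := huv (Ordinal (ltn_trans ai (ltn_ord i))); apply.
- move=> s; have [[u hu]|nu] := EM (exists u, forall i, (i < N)%N -> code u i = s i).
    apply: (final_u _ u) => // v hv; apply: insertion_ranks_inj => // j jN.
    by rewrite -/(code v j) -/(code u j) hv ?hu.
  apply: (final_u _ (fun=> 0)) => // v hv; case: nu; by exists v.
(* A rank lies between 0 and [j], so thresholds 0 and above [j] need no test. *)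
move=> j [|p] s A D jN As lo hi.
  by apply: solvesW hi _ _ => // v.
have [pj|jp] := ltnP p j; last first.
  by apply: solvesW lo _ _ => // v Av; split=> //; exact: leq_trans (below_le _ _ _) jp.
have [[u Au]|nu] := EM (exists u, A u); last first.
  by apply: solvesW lo _ _ => // v Av; case: nu; exists v.
(* All inputs in [A] share the earlier codes, hence the order of the first [j] forms. So [a] has
   rank [p] for each of them, and the rank test becomes a comparison of forms [a] and [j]. *)
have [a aj ap] := below_onto (st u) pj.
have test v : A v -> (p < code v j)%N = (lin (fun k => z a k - z j k) v <= 0).
  move=> Av; rewrite lin_sub subr_le0 -form_lt_le // (below_lt _ (st v) aj).
  rewrite -ap (@eq_below (form_lt z u) (form_lt z v)) // => i ij.
  apply: (@insertion_ranks_inj _ _ j) => // k kj.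
  exact: etrans (As u Au k kj) (esym (As v Av k kj)).
apply: (solves_test (c := fun k => z a k - z j k)).
  by apply: solvesW hi _ _ => // v [Av hv]; rewrite test.
apply: solvesW lo _ _ => // v [Av hv]; split=> //.
by rewrite ltnNge test // -ltNge.
Qed.

(** A running minimum with current best [i], in continuation form: the tree of depth [D] that
    follows may depend on the winner. *)
Lemma solves_argmin (w : nat -> 'I_m -> R) l i A D Q :
  (forall k, k \in i :: l ->
     solves D (fun v => A v /\ forall j, j \in i :: l -> lin (w k) v <= lin (w j) v) Q) ->
  solves (size l + D) A Q.
Proof.
elim: l i A => [|j l IH] i A h.
  apply: solvesW (h i (mem_head _ _)) _ _ => // v Av; split=> // k.
  by rewrite inE => /eqP->.
apply: (solves_test (c := fun t => w i t - w j t)).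
  apply: (IH i) => k ki; apply: solvesW (h k _) _ _ => //.
    by move: ki; rewrite !inE => /orP[] ->; rewrite ?orbT.
  move=> v [[Av]]; rewrite lin_sub subr_le0 => ij kmin; split=> // t.
  rewrite !inE => /or3P[/eqP->|/eqP->|tl].
  - by apply: kmin; rewrite mem_head.
  - by apply: le_trans ij; apply: kmin; rewrite mem_head.
  - by apply: kmin; rewrite inE tl orbT.
apply: (IH j) => k kj; apply: solvesW (h k _) _ _ => //.
  by rewrite inE kj orbT.
move=> v [[Av]]; rewrite lin_sub subr_gt0 => ji kmin; split=> // t.
rewrite inE => /orP[/eqP->|]; last exact: kmin.
by apply: le_trans (ltW ji); apply: kmin; rewrite mem_head.
Qed.

End Trees.

Lemma solves_all_argmin (R : realFieldType) (m n c : nat) (w : nat -> nat -> 'I_m -> R)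
    (B : ('I_m -> R) -> Prop) :
  (forall k, (k < n)%N -> exists i l, [/\ (size l <= c)%N,
     forall j, j \in i :: l -> (j <= k)%N &
     forall v, B v -> forall t, (t <= k)%N ->
       exists2 j, j \in i :: l & lin (w k j) v <= lin (w k t) v]) ->
  solves (n * c) B (fun v (o : 'I_n -> nat) => forall k : 'I_n,
    (o k <= k)%N /\ forall t, (t <= k)%N -> lin (w k (o k)) v <= lin (w k t) v).
Proof.
move=> cand; pose good v k i := (i <= k)%N /\
  forall t, (t <= k)%N -> lin (w k i) v <= lin (w k t) v.
(* Entries below [K] are already answered by [o], and [r] entries remain. *)
suff all_from r K o : (K + r = n)%N -> solves (r * c)
    (fun v => B v /\ forall k, (k < K)%N -> good v k (o k))
    (fun v (o : 'I_n -> nat) => forall k : 'I_n, good v k (o k)).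
  by apply: solvesW (all_from n 0%N (fun=> 0%N) (add0n n)) _ _.
elim: r K o => [|r IH] K o Kr.
  exists (Leaf R m (fun k : 'I_n => o k)); split=> // v [_ ok] k /=.
  by apply: ok; rewrite -(addn0 K) Kr.
have [|i [l [lc lK lmin]]] := cand K; first by lia.
apply: (solvesW (D := size l + r * c) (A := fun v => B v /\ forall k, (k < K)%N -> good v k (o k)))
  => //; last by rewrite mulSn leq_add2r.
apply: (solves_argmin (w := w K) (i := i)) => j jl.
apply: solvesW (IH K.+1 (fun k => if k == K then j else o k) _) _ _ => //; first by lia.
move=> v [[Bv ok] jmin]; split=> // k; rewrite ltnS leq_eqVlt.
case: eqP => [-> _|_ /= /ok //]; split; first exact: lK.
by move=> t /(lmin v Bv)[x xl xt]; apply: le_trans (jmin x xl) xt.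
Qed.

(** * Block minimisers from the order of short differences *)

Lemma leftmost_argmin (R : realFieldType) (f : nat -> R) a b : (a <= b)%N ->
  exists2 i, (a <= i <= b)%N & forall j, (a <= j <= b)%N ->
    if (i <= j)%N then f i <= f j else f i < f j.
Proof.
elim: b => [|b IH] ab.
  by exists 0%N => [|j jb]; [rewrite ab | rewrite (_ : j = 0%N) ?lexx //; lia].
have [ab1|ab1] := eqVneq a b.+1.
  exists a => [|j jb]; first by lia.
  by rewrite (_ : j = a) ?leqnn ?lexx //; lia.
have [|i iab imin] := IH; first by lia.
have [le|lt] := lerP (f i) (f b.+1).
  exists i => [|j]; first by lia.
  rewrite (leq_eqVlt j) ltnS => /andP[aj /orP[/eqP->|jb]]; last by apply: imin; rewrite aj.
  by case: leqP => //; lia.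
exists b.+1 => [|j]; first by lia.
rewrite (leq_eqVlt j) => /andP[aj /orP[/eqP->|jb]]; first by rewrite leqnn.
rewrite leqNgt jb /=; apply: lt_le_trans lt _.
by have := imin j; rewrite aj -ltnS jb => /(_ isT); case: leqP => // _ /ltW.
Qed.

Section Convolution.
Variables (R : realFieldType) (n d : nat).
Hypothesis d_gt0 : (0 < d)%N.

Definition coord (t : nat) : 'I_(n + n) -> R := fun j => (j == t :> nat)%:R.

Definition conv_term k i (j : 'I_(n + n)) : R := coord i j - coord (n + (k - i)) j.

(* Indices a = i d + e < n d encode x_i - x_(i+e), and
   a = n d + l d + e encode y_(l+e) - y_l. *)
Definition short_diff a (j : 'I_(n + n)) : R :=
  if (a < n * d)%N then coord (a %/ d) j - coord (a %/ d + a %% d) j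
  else let b := (a - n * d)%N in coord (n + (b %/ d + b %% d)) j - coord (n + b %/ d) j.

Lemma lin_coord t v (tn : (t < n + n)%N) : lin (coord t) v = v (Ordinal tn).
Proof.
rewrite /lin (bigD1 (Ordinal tn)) //= /coord eqxx mul1r big1 ?addr0 // => j.
by rewrite -val_eqE /= => /negPf->; rewrite mul0r.
Qed.

(** Here e = j - i and l = k - j. The x-difference has the smaller index, so a tie counts as
    [<=]. *)
Lemma form_lt_short_diff k i j v : (i <= j < i + d)%N -> (j <= k < n)%N ->
  form_lt short_diff v (i * d + (j - i))%N (n * d + ((k - j) * d + (j - i)))%N =
  (lin (conv_term k i) v <= lin (conv_term k j) v).
Proof.
move=> ij jk; have jid : (j - i < d)%N by lia.
have lt1 : (i * d + (j - i) < n * d)%N.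
  by apply: (@leq_trans (i.+1 * d)); [rewrite mulSn; lia | rewrite leq_pmul2r //; lia].
rewrite form_lt_le; last exact: leq_trans lt1 (leq_addr _ _).
have -> : lin (short_diff (i * d + (j - i))%N) v = lin (coord i) v - lin (coord j) v.
  rewrite -lin_sub; apply: eq_bigr => t _; rewrite /short_diff lt1.
  by rewrite divnMDl // divn_small // addn0 modnMDl modn_small // subnKC //; lia.
have -> : lin (short_diff (n * d + ((k - j) * d + (j - i)))) v =
    lin (coord (n + (k - i))) v - lin (coord (n + (k - j))) v.
  rewrite -lin_sub; apply: eq_bigr => t _; rewrite /short_diff.
  rewrite ltnNge leq_addr /= addKn divnMDl // divn_small // addn0 modnMDl modn_small //.
  by rewrite (_ : k - j + (j - i) = k - i)%N; last lia.
by rewrite !lin_sub; apply/idP/idP => ?; lra.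
Qed.

Definition same_order N (u v : 'I_(n + n) -> R) := forall a b, (a < N)%N -> (b < N)%N ->
  form_lt short_diff v a b = form_lt short_diff u a b.

(* The minimiser is the leftmost one for u: its comparisons are then those with
   smaller index on the left, as covered by form_lt_short_diff. *)
Lemma block_argmin u k q : (k < n)%N -> exists i, (q * d <= k)%N ->
  (i <= k)%N /\ forall v, same_order (2 * (n * d)) u v ->
    forall t, (t <= k)%N -> (t %/ d = q)%N ->
      lin (conv_term k i) v <= lin (conv_term k t) v.
Proof.
move=> kn; have [kq|qk] := ltnP k (q * d); first by exists 0%N; lia.
(* The last block is cut off at [k]. *)
have [|i iq imin] := @leftmost_argmin R (fun i => lin (conv_term k i) u)
  (q * d) (minn k (q * d + d.-1)); first by rewrite leq_min qk leq_addr.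
exists i => _; split; first by lia.
move=> v uv t tk tq.
have tqd : (q * d <= t <= minn k (q * d + d.-1))%N.
  by have := divn_eq t d; have := ltn_pmod t d_gt0; rewrite tq; lia.
have bound x y : (x <= y < x + d)%N -> (y <= k)%N ->
    (x * d + (y - x) < 2 * (n * d))%N && (n * d + ((k - y) * d + (y - x)) < 2 * (n * d))%N.
  move=> xy yk.
  have : (x.+1 * d <= n * d)%N by rewrite leq_pmul2r //; lia.
  have : ((k - y).+1 * d <= n * d)%N by rewrite leq_pmul2r //; lia.
  by rewrite !mulSn; lia.
have cmp x y : (x <= y < x + d)%N -> (y <= k)%N ->
    (lin (conv_term k x) v <= lin (conv_term k y) v) =
    (lin (conv_term k x) u <= lin (conv_term k y) u).
  move=> xy yk; have /andP[b1 b2] := bound x y xy yk.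
  by rewrite -!form_lt_short_diff ?yk // uv.
have := imin t tqd; case: leqP => it ui.
  by rewrite cmp //; lia.
by apply: ltW; rewrite ltNge cmp -?ltNge //; lia.
Qed.

Lemma solves_minconv l : ((2 * (2 * (n * d)) ^ 2 + 1) ^ (n + n) <= 2 ^ l)%N ->
  solves (2 * (2 * (n * d)) + 2 * l + n * (n %/ d)) (fun=> True)
    (fun v (o : 'I_n -> nat) => forall k : 'I_n, (o k <= k)%N /\
      forall t, (t <= k)%N -> lin (conv_term k (o k)) v <= lin (conv_term k t) v).
Proof.
move=> hl; apply: (@solves_sort _ _ _ short_diff) => // u.
apply: solves_all_argmin => k kn.
have [best hbest] := choice (fun q => block_argmin u q kn).
(* Block 0 supplies the initial candidate, leaving one comparison for each of the other k / d
   blocks. *)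
exists (best 0%N), [seq best q | q <- iota 1 (k %/ d)]; split.
- by rewrite size_map size_iota leq_div2r // ltnW.
- move=> j; rewrite -[_ :: _]/[seq best q | q <- iota 0 (k %/ d).+1].
  case/mapP=> q; rewrite mem_iota ltnS leq_divRL // => /hbest[qk _] ->; exact: qk.
- move=> v uv t tk; exists (best (t %/ d)%N).
    rewrite -[_ :: _]/[seq best q | q <- iota 0 (k %/ d).+1].
    by rewrite map_f // mem_iota ltnS leq_div2r.
  have /hbest[_] : (t %/ d * d <= k)%N by apply: leq_trans tk; apply: leq_divM.
  exact.
Qed.

End Convolution.

(** * Passage to [minconv] and choice of the block length *)

Lemma minconv_eq (R : realFieldType) (x y : nat -> R) k i : (i <= k)%N ->
  (forall t, (t <= k)%N -> x i - y (k - i)%N <= x t - y (k - t)%N) ->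
  x i - y (k - i)%N = minconv x y k.
Proof.
move=> ik imin; rewrite /minconv; apply/eqP; rewrite eq_le; apply/andP; split.
  rewrite big_mkord; elim/big_ind: _ => [|a b ha hb|t _].
  (* The default value of the minimum is the term of index 0. *)
  - by rewrite -[y k](congr1 y (subn0 k)); apply: imin.
  - by rewrite le_min ha.
  - by apply: imin; rewrite -ltnS.
rewrite big_mkord; have ik' : (i < k.+1)%N by [].
exact: (bigmin_le_cond _ (fun t : 'I_k.+1 => x t - y (k - t)%N) (j := Ordinal ik')).
Qed.

Lemma sqrt_bounds n : exists d, (d ^ 2 <= n < d.+1 ^ 2)%N.
Proof.
elim: n => [|n [d hd]]; first by exists 0%N.
by have [h|h] := ltnP n.+1 (d.+1 ^ 2)%N; [exists d | exists d.+1]; lia.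
Qed.

(** A crude form of n log (nd) = O(nd): as n <= 4 d^2, the base is at most 2^8 d^6, which is at most
    2^(14 d) because d < 2^d. *)
Lemma sign_bits n d : (0 < d)%N -> (n < d.+1 ^ 2)%N ->
  ((2 * (2 * (n * d)) ^ 2 + 1) ^ (n + n) <= 2 ^ (28 * (n * d)))%N.
Proof.
move=> d0 nd; rewrite (_ : 28 * (n * d) = (14 * d) * (n + n))%N; last by lia.
rewrite expnM; apply: leq_expl.
have nd2 : (n <= 4 * d ^ 2)%N by nia.
have ndd : (n * d <= 4 * d ^ 3)%N by rewrite [(d ^ 3)%N]expnSr mulnA leq_mul2r nd2 orbT.
apply: (@leq_trans (2 ^ 8 * d ^ 6)%N).
  have -> : (d ^ 6 = d ^ 3 * d ^ 3)%N by rewrite -expnD.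
  have : (0 < d ^ 3)%N by rewrite expn_gt0 d0.
  by move: ndd; move: (n * d)%N (d ^ 3)%N => a b; nia.
have -> : (14 * d = 8 * d + d * 6)%N by lia.
rewrite expnD; apply: leq_mul; first by rewrite leq_exp2l //; lia.
by rewrite expnM leq_expl // ltnW // ltn_expl.
Qed.

Close Scope ring_scope.
Unset Implicit Arguments.

(* Depth O(n sqrt n) is expressed as depth^2 <= C * n^3. *)
Theorem theorem4 :
  forall R : realFieldType, exists C : nat, forall n : nat,
    exists t : ldt R (n + n) ('I_n -> nat),
      computes_minconv t /\ (ldt_depth t ^ 2 <= C * n ^ 3)%N.
Proof.
(* 64 = 4 + 56 + 4, in units of nd: inserting 2nd forms, halving the outcomes, and n (n / d) <= 4nd
   final comparisons. Squaring then uses d^2 <= n. *)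
move=> R; exists (64 ^ 2) => n; case: (posnP n) => [->|n0].
  by exists (Leaf R _ (fun=> 0)); split=> // x y [].
have [d /andP[d1 d2]] := sqrt_bounds n.
have d0 : 0 < d by case: d d1 d2 => // _; lia.
have [t [dt ht]] := @solves_minconv R n d d0 _ (sign_bits d0 d2).
exists t; split.
  move=> x y k; set i := ldt_eval t _ k.
  have [ik imin] := ht (conv_input x y) I k; split=> //.
  apply: minconv_eq => // s sk.
  have termE s' : s' <= k ->
      lin (conv_term R k s') (conv_input (n := n) x y) = (x s' - y (k - s')%N)%R.
    move=> sk'; have kn := ltn_ord k.
    have s1 : s' < n + n by lia.
    have s2 : n + (k - s') < n + n by lia.
    rewrite lin_sub !(lin_coord _ s1) (lin_coord _ s2) /conv_input /=.
    by rewrite (leq_ltn_trans sk' kn) ltnNge leq_addr addKn.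
  by rewrite -!termE //; apply: imin.
have depth_le : ldt_depth t <= 64 * (n * d).
  apply: leq_trans dt _; have n4 : n <= 4 * d * d by nia.
  have : n %/ d <= 4 * d by rewrite -(mulnK (4 * d) d0) leq_div2r.
  by move/(leq_mul (leqnn n)); lia.
apply: (@leq_trans ((64 * (n * d)) ^ 2)); first by rewrite leq_exp2r.
by rewrite !expnMn leq_mul // (expnSr n 2) leq_mul.
Qed.
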